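(* Let $f:\mathbb{R}^N\to\mathbb{R}\cup\{\infty\}$, $f(x)=\|x\|_1$ for $x\in[-1,1]^N$ and $f(x)=\infty$ otherwise. Let $K_1,K_{-1}\subseteq[N]$ be disjoint, $x_{\pm1}=\mathbb{1}_{K_1}-\mathbb{1}_{K_{-1}}$, $k=|K_1\cup K_{-1}|$. Then $$\partial f(x_{\pm1})=\{s\in\mathbb{R}^N: s_i\ge1\ (i\in K_1),\ s_i\le -1\ (i\in K_{-1}),\ |s_i|\le 1\ (i\notin K_1\cup K_{-1})\},$$ and $$\delta(\mathcal{D}(f,x_{\pm1}))\le\Delta_{\pm\mathrm{ter}}(k):=\inf_{\tau\ge0}\Big[k\int_{-\infty}^{\tau}(u-\tau)^2\phi(u)\,du+2(N-k)\int_\tau^\infty(u-\tau)^2\phi(u)\,du\Big],$$ with $\phi(u)=(2\pi)^{-1/2}e^{-u^2/2}$.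
   Context: $\mathbb{1}_S$ has entries $1$ on $S$, $0$ elsewhere. Subdifferential: $\partial f(x_0)=\{s: f(y)-f(x_0)\ge\langle s,y-x_0\rangle\ \forall y\in\mathbb{R}^N\}$. Descent cone: $\mathcal{D}(f,x)=\bigcup_{\tau>0}\{y\in\mathbb{R}^N: f(x+\tau y)\le f(x)\}$. Statistical dimension of a closed convex cone $C$ (applied here to the closure of the descent cone): $\delta(C)=\mathbb{E}\|\pi_C(g)\|_2^2$, where $g$ is a standard normal vector in $\mathbb{R}^N$ and $\pi_C$ is the Euclidean projection onto $C$. *)

(* Defs.v *)
From HB Require Import structures.
From mathcomp Require Import all_boot all_order all_algebra.
From mathcomp Require Import all_classical all_reals all_analysis.
Set Implicit Arguments. Unset Strict Implicit. Unset Printing Implicit Defensive.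
Import Order.TTheory GRing.Theory Num.Theory.
Import numFieldNormedType.Exports.
Local Open Scope classical_set_scope.
Local Open Scope ring_scope.

Definition dotv {R : realType} {N : nat} (x y : 'rV[R]_N) : R :=
  \sum_(i < N) x 0 i * y 0 i.
Definition sqnorm {R : realType} {N : nat} (x : 'rV[R]_N) : R := dotv x x.

Definition indv {R : realType} {N : nat} (S : {set 'I_N}) : 'rV[R]_N :=
  \row_(i < N) (i \in S)%:R.

Definition l1_box {R : realType} {N : nat} (x : 'rV[R]_N) : \bar R :=
  if [forall i, `|x 0 i| <= 1] then (\sum_(i < N) `|x 0 i|)%:E else +oo%E.

Definition subdiff {R : realType} {N : nat} (f : 'rV[R]_N -> \bar R)
  (x0 : 'rV[R]_N) : set 'rV[R]_N :=
  [set s | forall y : 'rV[R]_N, ((dotv s (y - x0)%R)%:E <= f y - f x0)%E].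

Definition descent_cone {R : realType} {N : nat} (f : 'rV[R]_N -> \bar R)
  (x : 'rV[R]_N) : set 'rV[R]_N :=
  [set y | exists tau : R, 0 < tau /\ (f (x + tau *: y)%R <= f x)%E].

(* Euclidean projection onto a (closed convex) set C: a point of C at minimal
   Euclidean distance (unique when C is nonempty closed convex). *)
Definition proj {R : realType} {N : nat} (C : set 'rV[R]_N) (x : 'rV[R]_N)
  : 'rV[R]_N :=
  xget 0 [set p | C p /\ forall c, C c -> sqnorm (x - p) <= sqnorm (x - c)].

Definition phi {R : realType} (u : R) : R :=
  (Num.sqrt (2 * pi))^-1 * expR (- (u ^+ 2) / 2).

(* E[h(g)] for g a standard Gaussian vector in R^n, h nonnegative,
   computed as the iterated integral against the product density. *)
Fixpoint gauss_exp {R : realType} (n : nat) : (n.-tuple R -> \bar R) -> \bar R :=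
  match n with
  | 0 => fun h => h [tuple]
  | n'.+1 => fun h =>
      (\int[@lebesgue_measure R]_(t in [set: R])
         ((phi t)%:E * gauss_exp (fun v : n'.-tuple R => h [tuple of t :: v])))%E
  end.

Definition row_of_tuple {R : realType} {N : nat} (t : N.-tuple R) : 'rV[R]_N :=
  \row_(i < N) tnth t i.

Definition stat_dim {R : realType} {N : nat} (C : set 'rV[R]_N) : \bar R :=
  gauss_exp (fun t : N.-tuple R => (sqnorm (proj C (row_of_tuple t)))%:E).

Definition Delta_pm_ter {R : realType} (N k : nat) : \bar R :=
  ereal_inf [set v : \bar R | exists tau : R, 0 <= tau /\
    v = (k%:R%:E * \int[@lebesgue_measure R]_(u in [set` `]-oo, tau]])
                     (((u - tau) ^+ 2 * phi u)%:E)
         + (2 * (N - k))%N%:R%:E *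
             \int[@lebesgue_measure R]_(u in [set` `[tau, +oo[])
                     (((u - tau) ^+ 2 * phi u)%:E))%E].

(* Main.v *)
(* For tau >= 0 let B(tau) be tau times the subdifferential of f at x (for
   tau = 0, its recession cone).  Every z in B(tau) is in the polar of the
   descent cone, hence of its closure C, so |pi_C(g)|^2 <= |g - z|^2.  Taking
   for z the coordinatewise projection of g on B(tau) gives a bound that is a
   sum of functions of one coordinate each, whose Gaussian expectations are the
   integrals in Delta_pm_ter; the symmetry of phi treats the negative entries.
   As only an upper bound is needed, pi_C need be neither measurable nor even
   defined: the value 0 it takes when there is no minimizer satisfies the same
   bound. *)
Require Import Defs.
From HB Require Import structures.
From mathcomp Require Import all_boot all_order all_algebra.
From mathcomp Require Import all_classical all_reals all_analysis.
From mathcomp Require Import measurable_realfun ring lra.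
Import Order.TTheory GRing.Theory Num.Theory.
Import numFieldNormedType.Exports.
Local Open Scope classical_set_scope.
Local Open Scope ring_scope.

(** * Projections onto cones and polar vectors *)

Section EuclideanGeometry.
Context {R : realType} {N : nat}.
Implicit Types (x y z p : 'rV[R]_N) (C : set 'rV[R]_N).

Lemma dotvBl x y z : dotv (x - y) z = dotv x z - dotv y z.
Proof.
by rewrite /dotv -sumrB; apply: eq_bigr => i _; rewrite !mxE mulrBl.
Qed.

Lemma dotvZr (l : R) x y : dotv x (l *: y) = l * dotv x y.
Proof.
by rewrite /dotv mulr_sumr; apply: eq_bigr => i _; rewrite !mxE mulrCA.
Qed.

Lemma sqnormB x y : sqnorm (x - y) = sqnorm x - 2 * dotv x y + sqnorm y.
Proof.
rewrite /sqnorm /dotv mulr_sumr -sumrB -big_split /=.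
by apply: eq_bigr => i _; rewrite !mxE; ring.
Qed.

Lemma sqnormZ (l : R) x : sqnorm (l *: x) = l ^+ 2 * sqnorm x.
Proof.
rewrite /sqnorm /dotv mulr_sumr.
by apply: eq_bigr => i _; rewrite !mxE; ring.
Qed.

Lemma sqnorm_ge0 x : 0 <= sqnorm x.
Proof. by apply: sumr_ge0 => i _; rewrite -expr2 sqr_ge0. Qed.

(** Minimality of the projection p along its own ray gives |p|^2 <= <x, p>. As <z, p> <= 0,
    expanding |x - z - p|^2 >= 0 then yields |p|^2 <= |x - z|^2. *)
Lemma sqnorm_proj_le C x z :
  (forall (l : R) c, 0 < l -> C c -> C (l *: c)) ->
  (forall c, C c -> dotv z c <= 0) ->
  sqnorm (Defs.proj C x) <= sqnorm (x - z).
Proof.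
move=> Ccone zC; rewrite /Defs.proj; case: xgetP => [p _ [Cp pmin]|_]; last first.
  by rewrite -(scale0r (0 : 'rV[R]_N)) sqnormZ expr0n mul0r sqnorm_ge0.
(* The right-hand side is |x - l p|^2 - |x - p|^2, factored. *)
have pmin_ray (l : R) : 0 < l ->
    0 <= (l - 1) * ((l + 1) * sqnorm p - 2 * dotv x p).
  move=> l0; have := pmin _ (Ccone l p l0 Cp).
  by rewrite !sqnormB dotvZr sqnormZ; nra.
have q0 := sqnorm_ge0 p.
have qb : sqnorm p <= dotv x p.
  rewrite leNgt; apply/negP => bq.
  have [qpos|qle0] := ltP 0 (sqnorm p); last first.
    (* Here |p|^2 = 0, and comparing with p / 2 forces <x, p> >= 0. *)
    have := pmin_ray 2^-1 ltac:(lra); nra.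
  (* any l < 1 with l |p|^2 >= <x, p> strictly decreases the distance to x *)
  pose l := Num.max 2^-1 (dotv x p / sqnorm p).
  have l_half : 2^-1 <= l by rewrite /l le_max lexx.
  have l_b : dotv x p <= l * sqnorm p.
    by rewrite -ler_pdivrMr // /l le_max lexx orbT.
  have l1 : l < 1.
    by rewrite /l gt_max ltr_pdivrMr // mul1r bq andbT; lra.
  have := pmin_ray l ltac:(lra); nra.
have := sqnorm_ge0 ((x - z) - p); rewrite sqnormB dotvBl.
by have := zC p Cp; lra.
Qed.

Lemma closure_cone C :
  (forall (l : R) c, 0 < l -> C c -> C (l *: c)) ->
  forall (l : R) c, 0 < l -> closure C c -> closure C (l *: c).
Proof.
move=> Ccone l c l0 Cc B Bc.
have /Cc[y [Cy By]] := @scaler_continuous R _ l c _ Bc.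
by exists (l *: y); split => //; apply: Ccone.
Qed.

Lemma closure_polar C z :
  (forall c, C c -> dotv z c <= 0) -> forall c, closure C c -> dotv z c <= 0.
Proof.
move=> zC c.
have cz : continuous (dotv z).
  apply: continuous_big => [|i _ y]; first exact: add_continuous.
  by apply: continuousM; [exact: cst_continuous|exact: coord_continuous].
have clz : closed [set y | dotv z y <= 0].
  apply: (@preimage_closed _ _ (dotv z) [set r : R | r <= 0]).
    by move=> y _; exact: cz.
  exact: closed_le.
by move/(closureS zC); apply: clz.
Qed.

End EuclideanGeometry.

(** * Iterated Gaussian integrals and one-sided quadratic costs *)

Section GaussianExpectation.
Context {R : realType}.
Implicit Types (a u : R) (c : R -> R).
Local Notation mu := (@lebesgue_measure R).
Local Notation "''E' c" := (\int[mu]_u (c u * phi u)%:E)%E (at level 10).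

Lemma phiE : phi = normal_pdf 0 1 :> (R -> R).
Proof.
apply/funext => u; rewrite normal_pdfE ?oner_neq0 //.
by rewrite /phi /normal_peak /normal_fun expr1n mul1r subr0 mulr_natl.
Qed.

Lemma phi_ge0 u : 0 <= phi u.
Proof. by rewrite phiE normal_pdf_ge0. Qed.

Lemma phiN u : phi (- u) = phi u.
Proof. by rewrite /phi sqrrN. Qed.

Lemma measurable_phi : measurable_fun [set: R] (@phi R).
Proof. by rewrite phiE; exact: measurable_normal_pdf. Qed.

(** The integral of a nonnegative function is a supremum over the simple functions below it, and
    those below [f] are below [g]. In this generality it applies to integrands built from [proj]. *)
Lemma le_integralT (f g : R -> \bar R) :
  (forall u, 0 <= f u)%E -> (forall u, f u <= g u)%E ->
  (\int[mu]_u f u <= \int[mu]_u g u)%E.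
Proof.
move=> f0 fg; have g0 u : (0 <= g u)%E by exact: le_trans (f0 u) (fg u).
rewrite !ge0_integralTE //; apply: ereal_sup_le => _ [h hf <-].
by exists h => // u; exact: le_trans (hf u) (fg u).
Qed.

Lemma integralT_oppr (f : R -> \bar R) :
  measurable_fun [set: R] f -> (forall u, 0 <= f u)%E ->
  (\int[mu]_u f (- u)%R = \int[mu]_u f u)%E.
Proof.
move=> mf f0.
transitivity (\int[pushforward mu (-%R : R -> measurableTypeR R)]_u f u)%E.
  by rewrite ge0_integral_pushforward.
by apply: eq_measure_integral => A mA _; exact: lebesgue_measureN.
Qed.

Lemma gauss_exp_ge0 n (h : n.-tuple R -> \bar R) :
  (forall v, 0 <= h v)%E -> (0 <= gauss_exp h)%E.
Proof.
elim: n h => [|n IHn] h h0 /=; first exact: h0.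
apply: integral_ge0 => t _; rewrite mule_ge0 ?lee_fin ?phi_ge0 //.
exact: IHn.
Qed.

Lemma le_gauss_exp n (g h : n.-tuple R -> \bar R) :
  (forall v, 0 <= g v)%E -> (forall v, g v <= h v)%E ->
  (gauss_exp g <= gauss_exp h)%E.
Proof.
elim: n g h => [|n IHn] g h g0 gh /=; first exact: gh.
apply: le_integralT => t.
  by rewrite mule_ge0 ?lee_fin ?phi_ge0 // gauss_exp_ge0.
by rewrite lee_wpmul2l ?lee_fin ?phi_ge0 // IHn.
Qed.

(* The constant a lets the induction absorb the coordinate being integrated. *)
Lemma gauss_exp_sum n a (c : 'I_n -> R -> R) :
  0 <= a -> (forall i u, 0 <= c i u) ->
  (forall i, measurable_fun [set: R] (c i)) ->
  gauss_exp (fun v : n.-tuple R => (a + \sum_(i < n) c i (tnth v i))%:E) =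
  (a%:E + \sum_(i < n) 'E (c i))%E.
Proof.
elim: n a c => [|n IHn] a c a0 c0 mc; first by rewrite /= !big_ord0 addr0 adde0.
set S := (\sum_(i < n) 'E (c (lift ord0 i)))%E.
have S0 : (0 <= S)%E.
  apply: sume_ge0 => i _; apply: integral_ge0 => u _.
  by rewrite lee_fin mulr_ge0 ?phi_ge0.
(* With the first coordinate fixed at [t], its cost joins the constant, so the induction hypothesis
   applies with [a + c ord0 t]. *)
have step t :
    gauss_exp (fun v : n.-tuple R =>
      (a + \sum_(i < n.+1) c i (tnth [tuple of t :: v] i))%:E) =
    ((a + c ord0 t)%:E + S)%E.
  rewrite -IHn ?addr_ge0 //; congr gauss_exp; apply/funext => v.
  rewrite big_ord_recl tnth0 addrA; congr (_ + _)%:E.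
  by apply: eq_bigr => i _; rewrite tnthS.
rewrite /=; under eq_integral => t _.
  rewrite step EFinD -addeA muleDr ?ge0_adde_def ?inE ?lee_fin ?adde_ge0 ?lee_fin //.
  rewrite muleDr ?ge0_adde_def ?inE ?lee_fin //.
  rewrite -!EFinM ![phi t * _]mulrC.
  over.
have mphi : measurable_fun [set: R] (fun t => (phi t)%:E).
  by apply/measurable_EFinP; exact: measurable_phi.
have phi_int : (\int[mu]_t (phi t)%:E = 1)%E.
  by rewrite phiE integral_normal_pdf.
have E0 : (forall t, [set: R] t -> 0 <= (phi t)%:E)%E.
  by move=> t _; rewrite lee_fin phi_ge0.
have mc0 : measurable_fun [set: R] (fun t => (c ord0 t * phi t)%:E).
  by apply/measurable_EFinP/measurable_funM => //; exact: measurable_phi.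
have mS : measurable_fun [set: R] (fun t => (phi t)%:E * S)%E.
  by apply: emeasurable_funM => //; exact: measurable_cst.
have ma : measurable_fun [set: R] (fun t => (a * phi t)%:E).
  by apply/measurable_EFinP/measurable_funM => //; exact: measurable_phi.
have c0phi t : (0 <= (c ord0 t * phi t)%:E)%E by rewrite lee_fin mulr_ge0 ?phi_ge0.
rewrite ge0_integralD //; first last.
- exact: emeasurable_funD.
- by move=> t _; rewrite adde_ge0 ?mule_ge0 ?E0.
- by move=> t _; rewrite lee_fin mulr_ge0 ?phi_ge0.
rewrite ge0_integralD //; last by move=> t _; rewrite mule_ge0 ?E0.
under eq_integral => t _ do rewrite EFinM.
rewrite ge0_integralZl ?lee_fin // ge0_integralZr // phi_int mule1 mul1e.
by rewrite big_ord_recl.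
Qed.

(** Squared distance from [u] to the half-line [a, +oo[. Changing the signs of [a] and [u] gives
    every one-sided cost needed below. *)
Definition sq_shortfall a u : R := Num.max 0 (a - u) ^+ 2.

Lemma sq_shortfall_ge0 a u : 0 <= sq_shortfall a u.
Proof. exact: sqr_ge0. Qed.

Lemma measurable_sq_shortfall a : measurable_fun [set: R] (sq_shortfall a).
Proof.
apply: measurable_funX; apply: measurable_maxr => //.
exact: measurable_funB.
Qed.

Lemma measurable_sq_shortfallN a :
  measurable_fun [set: R] (fun u => sq_shortfall a (- u)).
Proof. exact: (measurableT_comp (measurable_sq_shortfall a)). Qed.

Lemma E_sq_shortfallN a :
  'E (fun u => sq_shortfall a (- u)) = 'E (sq_shortfall a).
Proof.
under eq_integral => u _ do rewrite -phiN.
apply: (integralT_oppr (fun u => (sq_shortfall a u * phi u)%:E)).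
  by apply/measurable_EFinP/measurable_funM;
    [exact: measurable_sq_shortfall|exact: measurable_phi].
by move=> u; rewrite lee_fin mulr_ge0 ?sqr_ge0 ?phi_ge0.
Qed.

Lemma E_sq_shortfall_lower a :
  'E (sq_shortfall a) =
  (\int[mu]_(u in [set` `]-oo, a]]) ((u - a) ^+ 2 * phi u)%:E)%E.
Proof.
rewrite [RHS]integral_mkcond; apply: eq_integral => u _.
rewrite patchE mem_setE in_itv /= /sq_shortfall.
case: (leP u a) => ua; first by rewrite max_r ?subr_ge0 // -sqrrN opprB.
by rewrite max_l ?expr0n ?mul0r // subr_le0 ltW.
Qed.

(** The reflection u -> -u turns the shortfall below [- a] into the excess over [a]. *)
Lemma E_sq_shortfall_upper a :
  'E (sq_shortfall (- a)) =
  (\int[mu]_(u in [set` `[a, +oo[]) ((u - a) ^+ 2 * phi u)%:E)%E.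
Proof.
rewrite -E_sq_shortfallN [RHS]integral_mkcond; apply: eq_integral => u _.
rewrite patchE mem_setE in_itv /= andbT /sq_shortfall opprK addrC.
case: (leP a u) => ua; first by rewrite max_r ?subr_ge0.
by rewrite max_l ?expr0n ?mul0r // subr_le0 ltW.
Qed.

End GaussianExpectation.

(** * Subdifferential and descent cone at a sign vector *)

Section SignVector.
Context {R : realType} {N : nat} (K1 Km1 : {set 'I_N}).
Hypothesis dK : [disjoint K1 & Km1]%B.
Implicit Types (w z s y : 'rV[R]_N) (tau : R).
Local Notation x := (indv K1 - indv Km1 : 'rV[R]_N).

Lemma sign_vecE i : x 0 i = if i \in K1 then 1 else if i \in Km1 then -1 else 0.
Proof.
rewrite !mxE; case: ifPn => iK1; first by rewrite (disjointFr dK iK1) subr0.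
by rewrite sub0r; case: ifP; rewrite ?oppr0.
Qed.

Lemma norm_sign_vec_le1 i : `|x 0 i| <= 1.
Proof.
by rewrite sign_vecE; (do 2?case: ifP => _); rewrite ?normrN ?normr1 ?normr0.
Qed.

Lemma l1_box_in w : (forall i, `|w 0 i| <= 1) ->
  l1_box w = (\sum_(i < N) `|w 0 i|)%:E.
Proof. by move=> wb; rewrite /l1_box ifT //; apply/forallP. Qed.

(* For tau > 0 this is tau times the subdifferential of l1_box at x. *)
Definition dual_box tau z := forall i,
  [/\ i \in K1 -> tau <= z 0 i, i \in Km1 -> z 0 i <= - tau &
      i \notin K1 :|: Km1 -> `|z 0 i| <= tau].

(** The inequality holds term by term. It serves twice: [tau = 1] gives the subgradient inequality,
    and general [tau] gives polarity to the descent cone. *)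
Lemma dual_box_dotv tau z w : 0 <= tau -> dual_box tau z ->
  (forall i, `|w 0 i| <= 1) ->
  dotv z (w - x) <= tau * (\sum_(i < N) `|w 0 i| - \sum_(i < N) `|x 0 i|).
Proof.
move=> tau0 zb wb; rewrite -sumrB mulr_sumr; apply: ler_sum => i _.
rewrite [(w - x) 0 i]mxE [(- x) 0 i]mxE sign_vecE.
have [zK1 zKm1 zK] := zb i; move: zK; rewrite inE negb_or.
have := wb i; rewrite ler_norml => /andP[w1 w2].
have wn : w 0 i <= `|w 0 i| := ler_norm _.
have wN : - w 0 i <= `|w 0 i| by rewrite -normrN ler_norm.
case: ifPn zK1 => [_ /(_ isT) zi _|_ _].
  (* The sum of this product and the next is exactly the difference of the two sides. *)
  have := mulr_ge0 (_ : 0 <= z 0 i - tau) (_ : 0 <= 1 - w 0 i).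
  have := mulr_ge0 tau0 (_ : 0 <= `|w 0 i| - w 0 i).
  by rewrite normr1 !subr_ge0 => /(_ wn) + /(_ zi w2); lra.
case: ifPn zKm1 => [_ /(_ isT) zi _|_ _ /(_ isT) zi].
  have := mulr_ge0 (_ : 0 <= - tau - z 0 i) (_ : 0 <= w 0 i - -1).
  have := mulr_ge0 tau0 (_ : 0 <= `|w 0 i| - - w 0 i).
  by rewrite normrN normr1 !subr_ge0 => /(_ wN) + /(_ zi w1); lra.
rewrite subr0 normr0 subr0 (le_trans (ler_norm _)) // normrM.
by rewrite ler_wpM2r.
Qed.

Lemma subdiff_l1_box : subdiff l1_box x = [set s | dual_box 1 s].
Proof.
apply/seteqP; split => s /=.
  move=> sx i.
  (* test the subgradient inequality on x with its i-th entry replaced by r *)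
  have test r : `|r| <= 1 -> s 0 i * (r - x 0 i) <= `|r| - `|x 0 i|.
    move=> r1; pose y : 'rV[R]_N := \row_j (if j == i then r else x 0 j).
    have yb j : `|y 0 j| <= 1 by rewrite mxE; case: ifP => // _; exact: norm_sign_vec_le1.
    have := sx y; rewrite !l1_box_in //; last exact: norm_sign_vec_le1.
    rewrite -EFinB lee_fin -sumrB /dotv.
    rewrite (bigD1 i) //= big1 => [|j /negbTE ji]; last first.
      by rewrite [(y - x) 0 j]mxE [(- x) 0 j]mxE [y 0 j]mxE ji subrr mulr0.
    rewrite (bigD1 i) //= big1 => [|j /negbTE ji]; last first.
      by rewrite [y 0 j]mxE ji subrr.
    by rewrite [(y - x) 0 i]mxE [(- x) 0 i]mxE [y 0 i]mxE eqxx !addr0.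
  (* The value 0 gives the bounds on [K1] and [Km1]; the values 1 and -1 give the two bounds
     elsewhere. *)
  have := (test 0, test 1, test (-1)); rewrite sign_vecE.
  rewrite !(normrN, normr1, normr0) => -[[t0 t1] tN1].
  have {}t0 := t0 ler01; have {}t1 := t1 (lexx _); have {}tN1 := tN1 (lexx _).
  split.
  - by move=> iK1; move: t0; rewrite iK1 normr1; lra.
  - move=> iKm1; move: t0; rewrite iKm1 (disjointFl dK iKm1) normrN normr1; lra.
  - rewrite inE negb_or => /andP[/negbTE iK1 /negbTE iKm1].
    move: t1 tN1; rewrite iK1 iKm1 normr0 ler_norml => t1 tN1.
    by apply/andP; split; lra.
move=> sb y; rewrite [l1_box x]l1_box_in; last exact: norm_sign_vec_le1.
have [/forallP yb|yb] := boolP [forall i, `|y 0 i| <= 1].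
  rewrite l1_box_in // -EFinB lee_fin -[leRHS]mul1r.
  exact: dual_box_dotv.
by rewrite {1}/l1_box (negbTE yb) leey.
Qed.

Lemma descent_cone_scale (l : R) y : 0 < l ->
  descent_cone l1_box x y -> descent_cone l1_box x (l *: y).
Proof.
move=> l0 [t [t0 xty]]; exists (t / l); split; first exact: divr_gt0.
by rewrite scalerA divfK ?gt_eqF.
Qed.

(** A descent step x + t y has finite value, so it stays in the cube, where [dual_box_dotv] bounds t
    <z, y> by [tau] times a nonpositive change of the norm. *)
Lemma dual_box_polar tau z y : 0 <= tau -> dual_box tau z ->
  descent_cone l1_box x y -> dotv z y <= 0.
Proof.
move=> tau0 zb [t [t0]]; rewrite [l1_box x]l1_box_in; last exact: norm_sign_vec_le1.
have [/forallP wb|wb] := boolP [forall i, `|(x + t *: y) 0 i| <= 1]; last first.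
  by rewrite /l1_box (negbTE wb) leye_eq.
rewrite l1_box_in // lee_fin => wx; rewrite -(pmulr_rle0 _ t0) -dotvZr.
have := dual_box_dotv _ _ _ tau0 zb wb; rewrite [x + _]addrC addrK.
move=> /le_trans; apply; rewrite mulr_ge0_le0 // subr_le0.
by rewrite addrC.
Qed.

Definition dual_proj tau (g : 'rV[R]_N) : 'rV[R]_N :=
  \row_i (if i \in K1 then Num.max tau (g 0 i)
          else if i \in Km1 then Num.min (- tau) (g 0 i)
          else Num.max (- tau) (Num.min tau (g 0 i))).

Lemma dual_proj_box tau g : 0 <= tau -> dual_box tau (dual_proj tau g).
Proof.
move=> tau0 i; rewrite mxE; split => [->|iKm1|].
- by rewrite le_max lexx.
- by rewrite iKm1 (disjointFl dK iKm1) ge_min lexx.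
- rewrite inE negb_or => /andP[/negbTE -> /negbTE ->].
  by rewrite ler_norml le_max lexx /= ge_max ge_min lexx; lra.
Qed.

(** For [tau >= 0], the squared distance from [u] to the i-th factor of [dual_box tau]. Off the
    support that factor is [-tau, tau], and at most one of the two summands is nonzero. *)
Definition coord_cost tau (i : 'I_N) (u : R) : R :=
  if i \in K1 then sq_shortfall tau u
  else if i \in Km1 then sq_shortfall tau (- u)
  else sq_shortfall (- tau) u + sq_shortfall (- tau) (- u).

Lemma coord_cost_ge0 tau i u : 0 <= coord_cost tau i u.
Proof.
by rewrite /coord_cost; (do 2?case: ifP => _); rewrite ?addr_ge0 ?sq_shortfall_ge0.
Qed.

Lemma measurable_coord_cost tau i : measurable_fun [set: R] (coord_cost tau i).
Proof.
rewrite /coord_cost; case: (i \in K1); [|case: (i \in Km1)].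
- exact: measurable_sq_shortfall.
- exact: measurable_sq_shortfallN.
- apply: measurable_funD; first exact: measurable_sq_shortfall.
  exact: measurable_sq_shortfallN.
Qed.

Lemma sqnorm_dual_proj tau g : 0 <= tau ->
  sqnorm (g - dual_proj tau g) <= \sum_(i < N) coord_cost tau i (g 0 i).
Proof.
move=> tau0; apply: ler_sum => i _; rewrite !mxE -expr2 /coord_cost /sq_shortfall.
set u := g 0 i.
case: ifP => _; [|case: ifP => _].
- by case: (leP tau u); case: (leP 0 (tau - u)); nra.
- by case: (leP (- tau) u); case: (leP 0 (tau - - u)); nra.
(* Beyond an end of [-tau, tau], the summand for that end is the exact squared distance; of the
   other only nonnegativity is used. *)
- have [tu|ut] := leP tau u.
    rewrite max_r; last by lra.
    rewrite [Num.max 0 (- tau - - u)]max_r; last by lra.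
    by have := sqr_ge0 (Num.max 0 (- tau - u)); nra.
  have [tNu|uNt] := leP (- tau) u; first by rewrite subrr expr0n addr_ge0 ?sqr_ge0.
  rewrite [Num.max 0 (- tau - u)]max_r; last by lra.
  by have := sqr_ge0 (Num.max 0 (- tau - - u)); nra.
Qed.

End SignVector.

(** * Bound on the statistical dimension *)

Section StatisticalDimensionBound.
Context {R : realType} {N : nat} (K1 Km1 : {set 'I_N}).
Hypothesis dK : [disjoint K1 & Km1]%B.
Local Notation mu := (@lebesgue_measure R).

Lemma stat_dim_le_coord_cost (tau : R) : 0 <= tau ->
  (stat_dim (closure (descent_cone l1_box (indv K1 - indv Km1 : 'rV[R]_N))) <=
   \sum_(i < N) \int[mu]_u (coord_cost K1 Km1 tau i u * phi u)%:E)%E.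
Proof.
move=> tau0.
have cost0 := coord_cost_ge0 K1 Km1 tau.
(* Read backwards with constant 0, [gauss_exp_sum] makes the right side one Gaussian expectation, so
   a pointwise comparison suffices. *)
rewrite -[leRHS]add0e -gauss_exp_sum //; last exact: measurable_coord_cost.
apply: le_gauss_exp => v; first by rewrite lee_fin sqnorm_ge0.
rewrite lee_fin add0r.
apply: (@le_trans _ _ (sqnorm (row_of_tuple v - dual_proj K1 Km1 tau (row_of_tuple v)))).
  apply: sqnorm_proj_le.
    by apply: closure_cone => l y; exact: descent_cone_scale.
  apply: closure_polar => y; apply: (dual_box_polar _ _ dK tau) => //.
  exact: dual_proj_box.
apply: le_trans (sqnorm_dual_proj K1 Km1 tau (row_of_tuple v) tau0) _.
by apply: ler_sum => i _; rewrite mxE.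
Qed.

(** By symmetry of [phi], each coordinate of the support contributes the same integral [A], and each
    other coordinate contributes two equal tails [B], whence the factor 2. *)
Lemma sum_coord_cost (tau : R) :
  (\sum_(i < N) \int[mu]_u (coord_cost K1 Km1 tau i u * phi u)%:E =
   #|K1 :|: Km1|%:R%:E * \int[mu]_(u in [set` `]-oo, tau]]) ((u - tau) ^+ 2 * phi u)%:E
   + (2 * (N - #|K1 :|: Km1|))%N%:R%:E *
     \int[mu]_(u in [set` `[tau, +oo[]) ((u - tau) ^+ 2 * phi u)%:E)%E.
Proof.
rewrite -E_sq_shortfall_lower -E_sq_shortfall_upper.
have E0 a : (0 <= \int[mu]_u (sq_shortfall a u * phi u)%:E)%E.
  by apply: integral_ge0 => u _; rewrite lee_fin mulr_ge0 ?sqr_ge0 ?phi_ge0.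
set A := (\int[mu]_u (sq_shortfall tau u * phi u)%:E)%E.
set B := (\int[mu]_u (sq_shortfall (- tau) u * phi u)%:E)%E.
have EK i : i \in K1 :|: Km1 ->
    (\int[mu]_u (coord_cost K1 Km1 tau i u * phi u)%:E = A)%E.
  rewrite inE /coord_cost; case: (i \in K1) => //= ->.
  exact: E_sq_shortfallN.
have EnK i : i \notin K1 :|: Km1 ->
    (\int[mu]_u (coord_cost K1 Km1 tau i u * phi u)%:E = B + B)%E.
  rewrite inE negb_or /coord_cost => /andP[/negbTE -> /negbTE ->] /=.
  under eq_integral => u _ do rewrite mulrDl EFinD.
  rewrite ge0_integralD //; first by rewrite E_sq_shortfallN.
  - by move=> u _; rewrite lee_fin mulr_ge0 ?sqr_ge0 ?phi_ge0.
  - apply/measurable_EFinP/measurable_funM; last exact: measurable_phi.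
    exact: measurable_sq_shortfall.
  - by move=> u _; rewrite lee_fin mulr_ge0 ?sqr_ge0 ?phi_ge0.
  - apply/measurable_EFinP/measurable_funM; last exact: measurable_phi.
    exact: measurable_sq_shortfallN.
rewrite (bigID [in K1 :|: Km1]) /= (eq_bigr _ EK) (eq_bigr _ EnK).
have cardN : #|[pred i | i \notin K1 :|: Km1]| = (N - #|K1 :|: Km1|)%N.
  rewrite -[X in (X - _)%N](card_ord N) -(cardC (mem (K1 :|: Km1))) addKn.
  by apply: eq_card => i; rewrite !inE.
(* [B] may a priori be infinite; its sign justifies distributing over [B + B] in the extended
   reals. *)
have B0 : (0 <= B)%E by exact: E0.
clearbody A B.
have natmulE (a : \bar R) n : (a *+ n)%R = (n%:R%:E * a)%E.
  by rewrite mule_natl; elim: n => // n IHn; rewrite mulrS muleS IHn.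
rewrite !sumr_const cardN !natmulE mul2n -addnn natrD EFinD.
by rewrite ge0_muleDl ?lee_fin // ge0_muleDr.
Qed.

End StatisticalDimensionBound.

Theorem theorem3p4 (R : realType) (N : nat) (K1 Km1 : {set 'I_N}) :
  [disjoint K1 & Km1]%B ->
  let x := (indv K1 - indv Km1 : 'rV[R]_N) in
  let k := #|K1 :|: Km1| in
  subdiff l1_box x =
    [set s : 'rV[R]_N | forall i : 'I_N,
       (i \in K1 -> 1 <= s 0 i) /\
       (i \in Km1 -> s 0 i <= -1) /\
       (i \notin K1 :|: Km1 -> `|s 0 i| <= 1)]
  /\ (stat_dim (closure (descent_cone l1_box x)) <= Delta_pm_ter N k)%E.
Proof.
move=> dK x k; split.
  rewrite subdiff_l1_box //; apply/seteqP.
  by split => s sb i; have := sb i; [case|case=> ? []].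
apply/ereal_infP => _ [tau [tau0 ->]].
by rewrite -sum_coord_cost; exact: stat_dim_le_coord_cost.
Qed.
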